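(* Let $m\ge2$, $r\ge1$, $(X,T)=(\Sigma_m,\sigma)$ the full shift, $\mathbb{B}$ a real Banach space, $W\subset\mathbb{B}$, and $\Phi:\Sigma_m^r\to\mathbb{B}^*$ continuous. Let $$L_{(\Phi,W)}=\{\alpha\in\mathbb{B}^*:\ E_\Phi(\alpha,W)\neq\emptyset\},\qquad f_{(\Phi,W)}(\alpha)=h_{\rm top}(E_\Phi(\alpha,W))\ \ (\alpha\in L_{(\Phi,W)}).$$ Then $f_{(\Phi,W)}:L_{(\Phi,W)}\to\mathbb{R}$ is upper semi-continuous.
   Context: $\Sigma_m=\{0,1,\dots,m-1\}^{\mathbb{N}}$ with the product topology (compact metric) and $\sigma$ the left shift. $\mathbb{B}^*$ carries the weak-star topology $\sigma(\mathbb{B}^*,\mathbb{B})$ and $\langle\cdot,\cdot\rangle$ is the duality pairing. For $\alpha\in\mathbb{B}^*$, $E_\Phi(\alpha,W)=\{x\in\Sigma_m:\limsup_{n\to\infty}\langle V_\Phi(n,x),w\rangle\le\langle\alpha,w\rangle$ for all $w\in W\}$, where $V_\Phi(n,x)=n^{-r}\sum_{1\le i_1,\dots,i_r\le n}\Phi(\sigma^{i_1}x,\dots,\sigma^{i_r}x)$. $h_{\rm top}(Z)$ is Bowen's topological entropy of a set $Z$: with $d_n(x,y)=\max_{0\le j<n}d(\sigma^jx,\sigma^jy)$, $B_n(x,\epsilon)$ the $d_n$-balls, $H^s_n(Z,\epsilon)=\inf\sum_ie^{-sn_i}$ over countable covers of $Z$ by balls $B_{n_i}(x_i,\epsilon)$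 with $n_i\ge n$, $H^s(Z,\epsilon)=\lim_nH^s_n(Z,\epsilon)$, $h_{\rm top}(Z,\epsilon)$ the critical value of $s$, and $h_{\rm top}(Z)=\lim_{\epsilon\to0}h_{\rm top}(Z,\epsilon)$. *)

(* Defs.v *)
From HB Require Import structures.
From mathcomp Require Import all_boot all_order all_algebra.
From mathcomp Require Import all_classical all_reals all_analysis.
Set Implicit Arguments. Unset Strict Implicit. Unset Printing Implicit Defensive.
Import Order.TTheory GRing.Theory Num.Theory.
Import numFieldNormedType.Exports.
Local Open Scope classical_set_scope.
Local Open Scope ring_scope.

Definition Sigma (m : nat) := nat -> 'I_m.
Definition shift {m : nat} (x : Sigma m) : Sigma m := fun k => x k.+1.

Section Shift.
Variable R : realType.
Variable m : nat.

(** Standard metric d(x,y) = 2^{-min{k : x_k <> y_k}} (0 if x = y),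
    written as sup{2^{-k} : x_k <> y_k} (sup of the empty set is 0). *)
Definition sdist (x y : Sigma m) : R :=
  sup [set ((2 : R) ^- k) | k in [set k : nat | x k != y k]].

Definition bowen_dist (n : nat) (x y : Sigma m) : R :=
  \big[Num.max/0]_(j < n) sdist (iter j shift x) (iter j shift y).
Definition bowen_ball (n : nat) (x : Sigma m) (eps : R) : set (Sigma m) :=
  [set y | bowen_dist n x y < eps].

(** A countable (possibly finite) family of Bowen balls is encoded by
    c : nat -> option (nat * Sigma m); [None] = no ball (contributes 0). *)
Definition cover_ball (eps : R) (o : option (nat * Sigma m)) : set (Sigma m) :=
  if o is Some (k, x) then bowen_ball k x eps else set0.
Definition cover_cost (s : R) (o : option (nat * Sigma m)) : \bar R :=
  if o is Some (k, _) then (expR (- (s * k%:R)))%:E else 0%E.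
Definition cover_ok (n : nat) (Z : set (Sigma m)) (eps : R)
    (c : nat -> option (nat * Sigma m)) : Prop :=
  (forall i, if c i is Some (k, _) then (n <= k)%N else true) /\
  Z `<=` \bigcup_i cover_ball eps (c i).

Definition Hsn (s : R) (n : nat) (Z : set (Sigma m)) (eps : R) : \bar R :=
  ereal_inf [set (\sum_(0 <= i <oo) cover_cost s (c i))%E
            | c in [set c | cover_ok n Z eps c]].
(** H^s(Z,eps) = lim_n H^s_n(Z,eps); the sequence is nondecreasing in n,
    so the limit is its supremum. *)
Definition Hs (s : R) (Z : set (Sigma m)) (eps : R) : \bar R :=
  ereal_sup [set Hsn s n Z eps | n in [set: nat]].
Definition htop_eps (Z : set (Sigma m)) (eps : R) : \bar R :=
  ereal_inf [set s%:E | s in [set s : R | Hs s Z eps = 0%E]].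
(** h_top(Z) = lim_{eps -> 0} h_top(Z,eps); nonincreasing in eps, so = sup. *)
Definition htop (Z : set (Sigma m)) : \bar R :=
  ereal_sup [set htop_eps Z eps | eps in [set eps : R | 0 < eps]].
End Shift.

Record dual (R : realType) (B : normedModType R) := Dual {
  dual_fun :> B -> R;
  dual_lin : forall (a : R) (u v : B), dual_fun (a *: u + v) = a * dual_fun u + dual_fun v;
  dual_cont : continuous dual_fun }.

Section Birkhoff.
Variables (R : realType) (B : normedModType R) (m r : nat).
Variable Phi : ('I_r -> Sigma m) -> dual B.

(** Continuity of Phi : Sigma_m^r -> (B^*, weak-star): since the weak-star
    topology is the initial topology of the evaluations at w in B, this means
    each x |-> <Phi x, w> is continuous on Sigma_m^r (product metric max_j d). *)
Definition weakstar_continuous : Prop :=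
  forall (w : B) (x : 'I_r -> Sigma m) (e : R), 0 < e ->
    exists2 delta : R, 0 < delta &
      forall y : 'I_r -> Sigma m, (forall j, sdist R (x j) (y j) < delta) ->
        `| Phi y w - Phi x w | < e.

Definition pairV (n : nat) (x : Sigma m) (w : B) : R :=
  (n%:R ^- r) * \sum_(i : {ffun 'I_r -> 'I_n}) Phi (fun j => iter (i j).+1 shift x) w.

Definition EPhi (alpha : dual B) (W : set B) : set (Sigma m) :=
  [set x | forall w, W w ->
     (limn_esup (fun n => (pairV n x w)%:E) <= (alpha w)%:E)%E].

Definition LPhi (W : set B) : set (dual B) := [set alpha | EPhi alpha W !=set0].
Definition fPhi (W : set B) (alpha : dual B) : \bar R := htop R (EPhi alpha W).
End Birkhoff.

(** Upper semicontinuity of f : L -> \bar R, L subset of B^* with the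
    (relative) weak-star topology, whose basic neighbourhoods of alpha are
    {beta : |<beta - alpha, w>| < delta for all w in a finite set ws}. *)
Definition weakstar_usc (R : realType) (B : normedModType R)
    (L : set (dual B)) (f : dual B -> \bar R) : Prop :=
  forall alpha, L alpha -> forall c : R, (f alpha < c%:E)%E ->
    exists ws : seq B, exists2 delta : R, 0 < delta &
      forall beta, L beta -> (forall w, w \in ws -> `| beta w - alpha w | < delta) ->
        (f beta < c%:E)%E.

(* Main.v *)
From HB Require Import structures.
From mathcomp Require Import all_boot all_order all_algebra.
From mathcomp Require Import all_classical all_reals all_analysis.
From mathcomp Require Import lra ring zify.
(* Last, because mathcomp-analysis has a [shift] of its own. *)
Require Import Defs.
Import Order.TTheory GRing.Theory Num.Theory.
Import numFieldNormedType.Exports.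
Local Open Scope classical_set_scope.
Local Open Scope ring_scope.

(** The V-statistics of [x] are determined, up to a small error, by polynomials
    in the word frequencies of [x].  Call a state (a family of candidate word
    frequencies) rich at level [c] if for every [c' < c] there are arbitrarily
    long lengths [n] for which at least [exp (c' n)] words of length [n] have
    frequencies close to it.  The space of states is compact.  If every state
    either fails to be rich at level [c] or violates some constraint
    [<V, w> <= <alpha, w>], then finitely many elements [w] and an error margin
    witness this uniformly, and counting words bounds the entropy of
    [E(beta, W)] below [c] for all [beta] close to [alpha].  Otherwise some rich
    state satisfies all the constraints; concatenating words with nearly these
    frequencies gives points of [E(alpha, W)] forming a set of entropy at least
    [c]. *)

(** * Prefixes of points and the words occurring in a set *)

Section Words.
Variable m : nat.
Implicit Types (x y : Sigma m) (u v : seq 'I_m) (n k j : nat).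

Lemma iter_shiftE j x k : iter j shift x k = x (j + k)%N.
Proof.
elim: j k => //= j IH k; rewrite /shift IH; congr x; lia.
Qed.

Lemma mkseq_agree n x y k : mkseq x n = mkseq y n -> (k < n)%N -> x k = y k.
Proof.
move=> h kn; have := congr1 (fun s => nth (x k) s k) h.
by rewrite !nth_mkseq.
Qed.

Lemma agree_mkseq n x y : (forall k, (k < n)%N -> x k = y k) ->
  mkseq x n = mkseq y n.
Proof.
move=> h; apply: (@eq_from_nth _ (x 0%N)); rewrite !size_mkseq // => i iN.
by rewrite !nth_mkseq // h.
Qed.

Lemma take_mkseq (T : Type) (f : nat -> T) k n :
  (k <= n)%N -> take k (mkseq f n) = mkseq f k.
Proof.
by move=> kn; rewrite /mkseq -map_take take_iota; congr map; congr iota; lia.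
Qed.

Definition starts v x := mkseq x (size v) == v.

Definition words n (A : set (Sigma m)) : {set n.-tuple 'I_m} :=
  [set u : n.-tuple 'I_m | `[< exists2 x, A x & mkseq x n = u >]]%SET.

Lemma mem_words n (A : set (Sigma m)) (u : n.-tuple 'I_m) :
  reflect (exists2 x, A x & mkseq x n = u) (u \in words n A).
Proof. by rewrite inE; apply: asboolP. Qed.

Lemma wordsS n (A A' : set (Sigma m)) : A `<=` A' -> words n A \subset words n A'.
Proof.
move=> AA; apply/fintype.subsetP => u /mem_words[x Ax xu].
by apply/mem_words; exists x => //; exact: AA.
Qed.

Lemma wordsU n (A A' : set (Sigma m)) :
  words n (A `|` A') = (words n A :|: words n A')%SET.
Proof.
apply/finset.setP => u; rewrite finset.in_setU; apply/mem_words/orP => [[x [Ax|Ax] xu]|].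
- by left; apply/mem_words; exists x.
- by right; apply/mem_words; exists x.
- by case=> /mem_words[x Ax xu]; exists x => //; [left|right].
Qed.

Lemma words0 n : words n set0 = finset.set0.
Proof. by apply/finset.setP => u; rewrite finset.in_set0; apply/mem_words => -[]. Qed.

End Words.

Arguments starts {m}.
Arguments words {m}.

(** * The metric and Bowen balls in terms of common prefixes *)

Section Metric.
Variables (R : realType) (m : nat).
Implicit Types (x y : Sigma m) (n k l j : nat).

Lemma sdist_ge x y k : x k != y k -> (2 : R) ^- k <= sdist R x y.
Proof.
move=> xy; apply: ub_le_sup; last by exists k.
by exists 1 => _ [i _ <-]; rewrite invf_le1 ?exprn_gt0// exprn_ege1// ler1n.
Qed.

Lemma sdist_le x y l : (forall k, (k < l)%N -> x k = y k) ->
  sdist R x y <= 2 ^- l.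
Proof.
move=> xy; rewrite /sdist; set S := (X in sup X).
have [->|S0] := eqVneq S set0; first by rewrite sup0.
apply: ge_sup; first exact/set0P.
move=> _ [i /= xyi <-]; have li : (l <= i)%N.
  by rewrite leqNgt; apply/negP => /xy xyE; rewrite xyE eqxx in xyi.
by rewrite lef_pV2 ?posrE ?exprn_gt0// ler_eXn2l ?ltr1n.
Qed.

Lemma sdist_lt1 x y : sdist R x y < 1 -> x 0%N = y 0%N.
Proof.
apply: contraTeq => xy; rewrite -leNgt.
by have := sdist_ge x y 0 xy; rewrite expr0 invr1.
Qed.

Lemma bowen_ball1_agree n x y k : bowen_ball n x (1 : R) y -> (k < n)%N -> x k = y k.
Proof.
rewrite /bowen_ball /bowen_dist /= => h kn.
have : sdist R (iter k shift x) (iter k shift y) < 1.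
  apply: le_lt_trans h.
  pose dj (j : 'I_n) := sdist R (iter j shift x) (iter j shift y).
  exact: (le_bigmax_cond 0 dj (j := Ordinal kn)).
by move/sdist_lt1; rewrite !iter_shiftE addn0.
Qed.

(** Each of the [n] shifted points must still agree on [l] letters, hence the prefix of length
    [n + l]. *)
Lemma agree_bowen_ball n l x y (e : R) : 2 ^- l < e ->
  (forall k, (k < n + l)%N -> x k = y k) -> bowen_ball n x e y.
Proof.
move=> le h; have e0 : 0 < e by apply: le_lt_trans le; rewrite invr_ge0 exprn_ge0.
rewrite /bowen_ball /bowen_dist /=; apply/bigmax_ltP; split => // j _.
apply: le_lt_trans le; apply: sdist_le => k kl; rewrite !iter_shiftE h //.
by have := ltn_ord j; lia.
Qed.

Lemma pow2V_lt (e : R) : 0 < e -> exists l, (2 : R) ^- l < e.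
Proof.
move=> e0; exists (Num.truncn e^-1).+1.
rewrite invf_plt ?posrE ?exprn_gt0//.
apply: lt_trans (truncnS_gt _) _.
by rewrite -natrX ltr_nat ltn_expl.
Qed.

End Metric.

(** * Uniform continuity on the product of shift spaces, in terms of cylinders *)

Section UniformContinuity.
Variables (R : realType) (m r : nat).
Implicit Types (x y z : 'I_r -> Sigma m) (k l : nat).

Definition agreeb k x y := [forall j, mkseq (x j) k == mkseq (y j) k].

Lemma agreebP k x y :
  reflect (forall j, mkseq (x j) k = mkseq (y j) k) (agreeb k x y).
Proof. by apply: (iffP forallP) => h j; apply/eqP/h. Qed.

Lemma agreeb_sym k x y : agreeb k x y = agreeb k y x.
Proof. by apply: eq_forallb => j; rewrite eq_sym. Qed.

Lemma agreeb_trans k x y z : agreeb k x y -> agreeb k y z -> agreeb k x z.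
Proof. by move=> /agreebP xy /agreebP yz; apply/agreebP => j; rewrite xy. Qed.

Lemma agreebW l k x y : (k <= l)%N -> agreeb l x y -> agreeb k x y.
Proof.
by move=> kl /agreebP xy; apply/agreebP => j; rewrite -!(take_mkseq _ _ _ _ kl) xy.
Qed.

Variable phi : ('I_r -> Sigma m) -> R.

Definition oscillation_lt k (e : R) := forall x y, agreeb k x y -> `|phi x - phi y| < e.

(* Koenig's lemma: a cylinder on which [phi] oscillates by [e] at every depth
   contains a cylinder of the next depth with the same property. *)
Lemma uniform_continuity :
  (forall x (e : R), 0 < e -> exists2 d : R, 0 < d &
     forall y, (forall j, sdist R (x j) (y j) < d) -> `|phi y - phi x| < e) ->
  forall e, 0 < e -> exists k, oscillation_lt k e.
Proof.
move=> phic e e0; apply: contrapT => nosc.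
pose bad k x := forall l, exists y z,
  [/\ agreeb k x y, agreeb l y z & e <= `|phi y - phi z|].
have step k x : bad k x -> exists x', agreeb k x x' /\ bad k.+1 x'.
  move=> badx; apply: contrapT => nx.
  pose ext (a : {ffun 'I_r -> 'I_m}) : 'I_r -> Sigma m :=
    fun j i => if (i < k)%N then x j i else a j.
  have xext a : agreeb k x (ext a).
    by apply/agreebP => j; apply: agree_mkseq => i ik; rewrite /ext ik.
  have exl a : exists l, forall y z, agreeb k.+1 (ext a) y -> agreeb l y z ->
      `|phi y - phi z| < e.
    apply: contrapT => nl; apply: nx; exists (ext a); split => // l.
    apply: contrapT => nyz; apply: nl; exists l => y z xy yz.
    by rewrite ltNge; apply/negP => h; apply: nyz; exists y, z.
  have [lf lfP] := choice exl.
  (* There are finitely many extensions by one letter per coordinate, so a single depth serves them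
     all; the pair [y], [z] falls into one of them. *)
  have [y [z [xy yz eyz]]] := badx (maxn k.+1 (\max_a lf a)).
  pose a := [ffun j => y j k]; move: eyz; apply/negP; rewrite -ltNge; apply: (lfP a).
    apply/agreebP => j; apply: agree_mkseq => i.
    rewrite ltnS leq_eqVlt /ext => /predU1P[->|ik].
      by rewrite ltnn ffunE.
    by rewrite ik; apply: (mkseq_agree _ _ _ _ _ (elimT (agreebP _ _ _) xy j)).
  by apply: agreebW yz; rewrite leq_max (leq_bigmax (F := lf) a) orbT.
have [x0 bad0] : exists x, bad 0%N x.
  have [x [y _]] : exists x y, True /\ e <= `|phi x - phi y|.
    apply: contrapT => nxy; apply: nosc; exists 0%N => x y _.
    by rewrite ltNge; apply/negP => h; apply: nxy; exists x, y.
  exists x => l; apply: contrapT => nyz; apply: nosc; exists l => y' z' yz.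
  rewrite ltNge; apply/negP => h; apply: nyz; exists y', z'; split => //.
  by apply/agreebP.
have /choice[nxt nxtP] : forall kx : nat * ('I_r -> Sigma m), exists x',
    bad kx.1 kx.2 -> agreeb kx.1 kx.2 x' /\ bad kx.1.+1 x'.
  move=> [k x] /=; have [/step[x' ?]|nb] := pselect (bad k x); first by exists x'.
  by exists x.
pose X := fix X k := if k is k'.+1 then nxt (k', X k') else x0.
have badX k : bad k (X k) by elim: k => //= k /(nxtP (k, X k))[].
have XS k : agreeb k (X k) (X k.+1) by have [] := nxtP (k, X k) (badX k).
have XX k d : agreeb k (X k) (X (k + d)%N).
  elim: d => [|d IH]; first by rewrite addn0; apply/agreebP.
  apply: agreeb_trans IH _; rewrite addnS; apply: agreebW (XS _); exact: leq_addr.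
(* The nested cylinders meet in this point; continuity there contradicts the oscillation on small
   cylinders around it. *)
pose x : 'I_r -> Sigma m := fun j k => X k.+1 j k.
have Xx k : agreeb k (X k) x.
  apply/agreebP => j; apply: agree_mkseq => i ik; rewrite /x.
  have /agreebP/(_ j) h := XX i.+1 (k - i.+1)%N; rewrite subnKC// in h.
  by rewrite (mkseq_agree _ _ _ _ _ h).
have [d d0 dP] := phic x _ (divr_gt0 e0 (ltr0n _ 2)).
have [l ld] := pow2V_lt R _ d0.
have near_x y : agreeb l x y -> `|phi y - phi x| < e / 2%:R.
  move=> /agreebP xy; apply: dP => j; apply: le_lt_trans ld; apply: sdist_le => k.
  exact: mkseq_agree.
have [y [z [Xy yz eyz]]] := badX l l.
have xy : agreeb l x y by apply: agreeb_trans Xy; rewrite agreeb_sym.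
have yx := near_x _ xy; have zx := near_x _ (agreeb_trans _ _ _ _ xy yz).
move: eyz; apply/negP; rewrite -ltNge.
have -> : phi y - phi z = (phi y - phi x) - (phi z - phi x) by ring.
apply: le_lt_trans (ler_normB _ _) _; lra.
Qed.

End UniformContinuity.

Arguments oscillation_lt {R m r}.

(** * Limits of finite sums and products *)

Section CvgBig.
Variables (R : realType) (T I : Type) (F : set_system T) (s : seq I).
Variables (f : I -> T -> R) (l : I -> R).
Context {FF : Filter F}.
Hypothesis fl : forall i, f i t @[t --> F] --> l i.

Lemma cvg_bigsum : (\sum_(i <- s) f i t) @[t --> F] --> \sum_(i <- s) l i.
Proof.
elim: s => [|i s' IH].
  by rewrite big_nil; under eq_fun do rewrite big_nil; exact: cvg_cst.
by rewrite big_cons; under eq_fun do rewrite big_cons; exact: cvgD.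
Qed.

Lemma cvg_bigprod : (\prod_(i <- s) f i t) @[t --> F] --> \prod_(i <- s) l i.
Proof.
elim: s => [|i s' IH].
  by rewrite big_nil; under eq_fun do rewrite big_nil; exact: cvg_cst.
by rewrite big_cons; under eq_fun do rewrite big_cons; exact: cvgM.
Qed.

End CvgBig.

(** * V-statistics as polynomials in word frequencies *)

Section Frequencies.
Variables (R : realType) (m r : nat).
Implicit Types (x y : Sigma m) (u v : seq 'I_m) (n k : nat).

Definition emp n x v : R := (\sum_(i < n) (starts v (iter i.+1 shift x))%:R) / n%:R.

Lemma emp_itv n x v : emp n x v \in `[0, 1].
Proof.
rewrite in_itv /= /emp -natr_sum divr_ge0//=.
have [->|n0] := posnP n; first by rewrite invr0 mulr0.
rewrite ler_pdivrMr ?ltr0n// mul1r ler_nat.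
rewrite -[leqRHS]card_ord -sum1_card; apply: leq_sum => i _; exact: leq_b1.
Qed.

Definition Vstat (phi : ('I_r -> Sigma m) -> R) n x : R :=
  n%:R ^- r * \sum_(i : {ffun 'I_r -> 'I_n}) phi (fun j => iter (i j).+1 shift x).

Variables (phi : ('I_r -> Sigma m) -> R) (z : 'I_m).

Definition pad u : Sigma m := nth z u.

(** The integral against [q^r] of the approximation of [phi] that only looks at
    the first [k] letters, as a polynomial in the word frequencies [q]. *)
Definition Lam k (q : seq 'I_m -> R) : R :=
  \sum_(u : {ffun 'I_r -> k.-tuple 'I_m}) phi (fun j => pad (u j)) * \prod_j q (u j).

Lemma Lam_cvg (T : Type) (F : set_system T) {FF : Filter F} k
    (g : T -> seq 'I_m -> R) (p : seq 'I_m -> R) :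
  (forall v, g t v @[t --> F] --> p v) -> Lam k (g t) @[t --> F] --> Lam k p.
Proof.
move=> gp; apply: cvg_bigsum => u; apply: cvgM; first exact: cvg_cst.
exact: cvg_bigprod.
Qed.

(** Expanding the product of frequencies gives a sum over index tuples [i], and each [i] is counted
    by exactly one family of words, namely [w i], read at its positions. *)
Lemma Lam_emp n x k :
  Lam k (emp n x) = Vstat (fun xs => phi (fun j => pad (mkseq (xs j) k))) n x.
Proof.
rewrite /Lam /Vstat mulr_sumr.
pose w (i : {ffun 'I_r -> 'I_n}) : {ffun 'I_r -> k.-tuple 'I_m} :=
  [ffun j => [tuple of mkseq (iter (i j).+1 shift x) k]].
transitivity (\sum_(u : {ffun 'I_r -> k.-tuple 'I_m})
   \sum_(i : {ffun 'I_r -> 'I_n}) n%:R ^- r * (phi (fun j => pad (u j)) * (u == w i)%:R)).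
  apply: eq_bigr => u _; rewrite big_split /= prodr_const card_ord exprVn.
  rewrite mulrA mulrC -mulr_sumr; congr (_ * _).
  rewrite bigA_distr_bigA /= mulr_sumr; apply: eq_bigr => i _; congr (_ * _).
  rewrite -natr_prod; congr _%:R.
  have [->|uw] := eqVneq u (w i).
    by rewrite big1 // => j _; rewrite /starts ffunE /= size_mkseq eqxx.
  have [j ujw] : exists j, u j != w i j.
    apply/existsP; apply: contraNT uw; rewrite negb_exists => /forallP h.
    by apply/eqP/ffunP => j; apply/eqP; rewrite -[_ == _]negbK.
  rewrite (bigD1 j) //= /starts size_tuple.
  by move: ujw; rewrite ffunE -val_eqE eq_sym /= => /negbTE ->; rewrite mul0n.
rewrite exchange_big /=; apply: eq_bigr => i _.
rewrite (bigD1 (w i)) //= eqxx mulr1 big1 ?addr0; last first.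
  by move=> u /negbTE ->; rewrite !mulr0.
by congr (_ * phi _); apply: funext => j; rewrite ffunE.
Qed.

(** Truncating the arguments to [k] letters changes each of the [n ^ r] terms by less than [e]. *)
Lemma Vstat_Lam n x k (e : R) : (0 < n)%N -> 0 <= e -> oscillation_lt phi k e ->
  `|Vstat phi n x - Lam k (emp n x)| <= e.
Proof.
move=> n0 e0 osc; rewrite Lam_emp /Vstat -mulrBr -sumrB normrM ger0_norm; last first.
  by rewrite invr_ge0 exprn_ge0.
rewrite mulrC ler_pdivrMr ?exprn_gt0 ?ltr0n//.
apply: le_trans (ler_norm_sum _ _ _) _.
apply: le_trans (ler_sum _ (G := fun=> e) _) _.
  move=> i _; apply/ltW/osc/agreebP => j; apply: agree_mkseq => a ak.
  by rewrite /pad nth_mkseq.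
by rewrite sumr_const card_ffun !card_ord -natrX mulr_natr.
Qed.

End Frequencies.

Arguments emp R {m}.
Arguments Vstat {R m r}.
Arguments Lam {R m r}.

(** * Upper bound for entropy by counting words *)

Section UpperBound.
Variables (R : realType) (m : nat) (z : 'I_m).
Implicit Types (u : seq 'I_m) (A : nat -> set (Sigma m)).

Let dec (i : nat) : option (seq 'I_m) := pickle_inv i.

(** A partial sum of the series involves finitely many distinct words, hence bounded lengths, and
    can be regrouped by length. *)
Lemma nneseries_words_le (f : seq 'I_m -> R) (a : nat -> R) (b : R) :
  (forall u, 0 <= f u) -> (forall N, \sum_(u : N.-tuple 'I_m) f u <= a N) ->
  (forall L, \sum_(N < L) a N <= b) ->
  (\sum_(0 <= i <oo) (oapp f 0 (dec i))%:E <= b%:E)%E.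
Proof.
move=> f0 fa ab.
have g0 i : 0 <= oapp f 0 (dec i) by case: (dec i) => /=.
apply: lime_le; first by apply: is_cvg_nneseries => i _ _; rewrite lee_fin.
apply: nearW => I; rewrite sumEFin lee_fin.
pose S := pmap dec (iota 0 I).
have -> : \sum_(0 <= i < I) oapp f 0 (dec i) = \sum_(u <- S) f u.
  rewrite /index_iota subn0 /S; elim: (iota 0 I) => [|i s IH]; first by rewrite !big_nil.
  by rewrite big_cons IH /=; case: (dec i) => [u|] /=; rewrite ?big_cons ?add0r.
have uS : uniq S.
  by apply: (@pmap_uniq _ _ _ pickle); [exact: pickle_invK | exact: iota_uniq].
pose L := (\max_(u <- S) size u).+1.
apply: le_trans (ab L).
have fE u : u \in S ->
    f u = \sum_(N < L) \sum_(t : N.-tuple 'I_m) (val t == u)%:R * f t.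
  move=> uinS; have uL : (size u < L)%N by rewrite ltnS; exact: leq_bigmax_seq.
  rewrite (bigD1 (Ordinal uL)) //= [X in _ + X]big1 ?addr0; last first.
    move=> N NL; rewrite big1// => t _; case: eqP => [tu|]; last by rewrite mul0r.
    by move: NL; rewrite -val_eqE /= -tu size_tuple eqxx.
  rewrite (bigD1 (in_tuple u)) //= eqxx mul1r big1 ?addr0// => t tu.
  by rewrite -val_eqE /= in tu; rewrite (negbTE tu) mul0r.
rewrite (eq_big_seq _ fE) exchange_big /=; apply: ler_sum => N _.
apply: le_trans (fa N); rewrite exchange_big /=; apply: ler_sum => t _.
rewrite -mulr_suml ler_piMl// -natr_sum -[leRHS]/(1%:R) ler_nat.
rewrite (eq_bigr (fun u => if u == val t then 1%N else 0%N)); last first.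
  by move=> u _; rewrite eq_sym; case: eqP.
by rewrite -big_mkcond sum1_count (@count_uniq_mem _ _ (val t))// leq_b1.
Qed.

Lemma sum_geometric_tail (q : R) (M L : nat) : 0 < q < 1 ->
  \sum_(N < L) (if (M <= N)%N then q ^+ N else 0) <= q ^+ M / (1 - q).
Proof.
move=> /andP[q0 q1]; have d0 : 0 < 1 - q by rewrite subr_gt0.
rewrite ler_pdivlMr//.
(* The product telescopes; [maxn M L] makes the right-hand side vanish when [L <= M], where the sum
   is empty. *)
suff -> : (\sum_(N < L) (if (M <= N)%N then q ^+ N else 0)) * (1 - q) =
    q ^+ M - q ^+ maxn M L by rewrite gerBl exprn_ge0// ltW.
elim: L => [|L IH]; first by rewrite big_ord0 mul0r maxn0 subrr.
rewrite big_ord_recr /= mulrDl IH; case: leqP => ML.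
  by rewrite (maxn_idPr (leqW ML)) exprS; ring.
by rewrite mul0r addr0 (maxn_idPl ML).
Qed.

Lemma Hsn_ge0 (s : R) n (Z : set (Sigma m)) (e : R) : (0 <= Hsn s n Z e)%E.
Proof.
apply: le_ereal_inf_tmp => _ [c _ <-]; apply: nneseries_ge0 => i _ _.
by case: (c i) => [[k x]|] //=; rewrite lee_fin expR_ge0.
Qed.

Lemma Hs_ge0 (s : R) (Z : set (Sigma m)) (e : R) : (0 <= Hs s Z e)%E.
Proof.
apply: (@le_trans _ _ (Hsn s 0 Z e)); first exact: Hsn_ge0.
by apply: ereal_sup_ubound; exists 0%N.
Qed.

(** Every point of [Z] lies in [A n] for arbitrarily large [n], so for each [M] the words of length
    at least [M] coming from the sets [A n] give a cover of [Z]. At exponent [c + d] its cost is the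
    tail of a geometric series. *)
Lemma htop_le A (C c : R) N0 (Z : set (Sigma m)) :
  (forall n, (N0 <= n)%N -> #|words n (A n)|%:R <= C * expR (c * n%:R)) ->
  (forall x, Z x -> forall N, exists2 n, (N <= n)%N & A n x) ->
  (htop R Z <= c%:E)%E.
Proof.
move=> hA hZ; apply: ge_ereal_sup => _ [e /= e0 <-].
apply/lee_addgt0Pr => d d0; apply: ereal_inf_lbound => /=.
exists (c + d); last by rewrite EFinD.
apply/eqP; rewrite eq_le Hs_ge0 andbT; apply: ge_ereal_sup => _ [n0 _ <-].
apply/lee_addgt0Pr => eta eta0; rewrite add0e.
have [l le] := pow2V_lt R _ e0.
pose q := expR (- d); set s := c + d.
have q0 : 0 < q by exact: expR_gt0.
have q1 : q < 1 by rewrite -expR0 ltr_expR oppr_lt0.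
have C0 : 0 <= C.
  rewrite -(pmulr_lge0 _ (expR_gt0 (c * N0%:R))).
  by apply: le_trans (hA N0 (leqnn _)); exact: ler0n.
(* At most [C * expR (c * N)] words of length [N], each of cost [expR (- (s * (N - l)))], cost
   [C * expR (s * l) * q ^+ N] together; summing over [N >= M] gives [K * q ^+ M]. *)
pose K := C * expR (s * l%:R) / (1 - q).
have K0 : 0 <= K by rewrite divr_ge0 ?mulr_ge0 ?expR_ge0// subr_ge0 ltW.
have [M [NM lM KM]] : exists M, [/\ (N0 <= M)%N, (n0 + l <= M)%N & K * q ^+ M <= eta].
  have /cvgr0_norm_le/(_ _ eta0) : (K * q ^+ n @[n --> \oo] --> 0).
    by apply: (cvg_geometric K); rewrite ger0_norm // ltW.
  case=> M1 _ hM1; exists (maxn M1 (maxn N0 (n0 + l))); split; [lia|lia|].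
  apply: le_trans (ler_norm _) _; apply: hM1; rewrite /=; lia.
pose good u := (M <= size u)%N && `[< exists2 x, A (size u) x & mkseq x (size u) = u >].
pose f u := if good u then expR (- (s * (size u - l)%:R)) else 0 : R.
(* The order drops by [l] because a ball of order [n] and radius [e] contains a cylinder of length
   [n + l]. *)
pose cov i : option (nat * Sigma m) :=
  if dec i is Some u then
    if good u then Some ((size u - l)%N, pad m z u) else None
  else None.
apply: (@le_trans _ _ (\sum_(0 <= i <oo) cover_cost s (cov i))%E).
  apply: ereal_inf_lbound; exists cov => //; split.
    move=> i; rewrite /cov; case: (dec i) => // u; case: ifP => // /andP[uM _]; lia.
  move=> x Zx; have [n Mn Anx] := hZ x Zx M.
  exists (pickle (mkseq x n)) => //; rewrite /cov /dec pickleK_inv /=.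
  rewrite /good size_mkseq Mn (_ : `[< _ >] = true) /=; last by apply/asboolP; exists x.
  apply: agree_bowen_ball le _ => k kn; rewrite /pad nth_mkseq//; lia.
rewrite (@eq_eseriesr _ _ (fun i => (oapp f 0 (dec i))%:E)); last first.
  by move=> i _; rewrite /cov; case: (dec i) => //= u; rewrite /f; case: ifP.
apply: le_trans (nneseries_words_le f
   (fun N => C * expR (s * l%:R) * (if (M <= N)%N then q ^+ N else 0))
   (K * q ^+ M) _ _ _) _.
- by move=> u; rewrite /f; case: ifP => // _; exact: expR_ge0.
- move=> N; case: leqP => MN; last first.
    rewrite mulr0 big1// => u _; rewrite /f /good size_tuple leqNgt MN //.
  rewrite (bigID (fun u : N.-tuple 'I_m => u \in words N (A N))) /=.
  rewrite [X in _ + X]big1 ?addr0; last first.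
    move=> u uA; rewrite /f /good size_tuple MN /=; case: asboolP => // h.
    by case/negP: uA; apply/mem_words.
  have fle : \sum_(t in words N (A N)) f t <=
      \sum_(t in words N (A N)) expR (- (s * (N - l)%:R)).
    by apply: ler_sum => u _; rewrite /f size_tuple; case: ifP; rewrite ?expR_ge0.
  apply: le_trans fle _; rewrite sumr_const -[leLHS]mulr_natl.
  apply: le_trans (ler_wpM2r (expR_ge0 _) (hA N (leq_trans NM MN))) _.
  rewrite -!mulrA ler_wpM2l// /q -expRM_natl -!expRD ler_expR.
  rewrite natrB; last lia.
  rewrite /s mulr_natl -mulr_natr; lra.
- move=> L; rewrite -mulr_sumr /K [leRHS]mulrAC -[leRHS]mulrA.
  by rewrite ler_wpM2l ?mulr_ge0 ?expR_ge0//; apply: sum_geometric_tail; rewrite q0 q1.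
- by rewrite lee_fin.
Qed.

End UpperBound.

Lemma sum_const_seq (R : pzSemiRingType) (T : Type) (s : seq T) (a : R) :
  \sum_(g <- s) a = a * (size s)%:R.
Proof. by rewrite big_const_seq count_predT iter_addr_0 mulr_natr. Qed.

(** * Lower bound for the entropy of a set of concatenations *)

Section LowerBound.
Variables (R : realType) (m : nat) (z : 'I_m).
Variables (G : nat -> seq (seq 'I_m)) (ell : nat -> nat) (c : R).
Hypothesis G_uniq : forall j, uniq (G j).
Hypothesis G_size : forall j g, g \in G j -> size g = ell j.
Hypothesis ell_gt0 : forall j, (0 < ell j)%N.
Hypothesis G_card : forall j, expR (c * (ell j)%:R) <= (size (G j))%:R.

Definition offset j := (\sum_(i < j) ell i)%N.

(** The mass estimate below counts only completed blocks, so an unfinished block has to be short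
    compared with what precedes it. *)
Hypothesis ell_sublinear : forall eta : R, 0 < eta ->
  exists K : R, forall j, (ell j)%:R <= eta * (offset j)%:R + K.

Definition concatenations : set (Sigma m) :=
  [set x | forall j, mkseq (iter (offset j) shift x) (ell j) \in G j].

Let card_gt0 j : 0 < (size (G j))%:R :> R.
Proof. by apply: lt_le_trans (G_card j); exact: expR_gt0. Qed.

Lemma offsetS j : offset j.+1 = (offset j + ell j)%N.
Proof. by rewrite /offset big_ord_recr. Qed.

Lemma leq_offset j : (j <= offset j)%N.
Proof. by elim: j => // j IH; rewrite offsetS; have := ell_gt0 j; lia. Qed.

Lemma offset_homo i j : (i <= j)%N -> (offset i <= offset j)%N.
Proof.
move/subnKC <-; elim: (j - i)%N => [|d IH]; first by rewrite addn0.
by rewrite addnS offsetS; lia.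
Qed.

Lemma offset_between N : exists J, (offset J <= N < offset J.+1)%N.
Proof.
have ex : exists J, (offset J <= N)%N by exists 0%N; rewrite /offset big_ord0.
have bd J : (offset J <= N)%N -> (J <= N)%N by have := leq_offset J; lia.
case: (ex_maxnP ex bd) => J JN JM; exists J; rewrite JN /= ltnNge.
by apply/negP => /JM; rewrite ltnn.
Qed.

(** The probability that the first [N] letters agree with [y] when the prefix
    [u] is followed by independent uniform choices of the blocks
    [j], ..., [j + f - 1]. *)
Fixpoint mass (N : nat) (y : Sigma m) (f j : nat) (u : seq 'I_m) : R :=
  if f is f'.+1 then (\sum_(g <- G j) mass N y f' j.+1 (u ++ g)) / (size (G j))%:R
  else (take N u == mkseq y N)%:R.

Lemma mass_itv N y f j u : 0 <= mass N y f j u <= 1.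
Proof.
elim: f j u => [|f IH] j u /=; first by rewrite ler0n lern1 leq_b1.
rewrite divr_ge0 ?sumr_ge0//= => [|g _]; last by case/andP: (IH j.+1 (u ++ g)).
rewrite ler_pdivrMr// -sum_const_seq.
by apply: ler_sum => g _; case/andP: (IH j.+1 (u ++ g)).
Qed.

(** Later blocks never alter a letter already written. *)
Lemma mass_mismatch N y f j u k : (k <= N)%N -> (k <= size u)%N ->
  take k u != mkseq y k -> mass N y f j u = 0.
Proof.
move=> kN; elim: f j u => [|f IH] j u ku uy /=.
  case: eqP => // h; case/negP: uy; apply/eqP.
  by rewrite -(take_mkseq _ y _ _ kN) -h take_takel.
by rewrite big1 ?mul0r// => g _; apply: IH; rewrite ?size_cat ?takel_cat//; lia.
Qed.

(** For each block before [J] at most one choice, [g0], keeps the agreement with [y], and [G_card]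
    bounds its probability. *)
Lemma mass_le N y J f j u : (offset J <= N)%N -> (j <= J <= j + f)%N ->
  size u = offset j ->
  mass N y f j u <= expR (- (c * ((offset J)%:R - (offset j)%:R))).
Proof.
move=> JN; elim: f j u => [|f IH] j u /andP[jJ Jf] uj.
  have -> : J = j by lia.
  by rewrite subrr mulr0 oppr0 expR0; case/andP: (mass_itv N y 0 j u).
have [<-|jJ'] := eqVneq j J.
  by rewrite subrr mulr0 oppr0 expR0; case/andP: (mass_itv N y f.+1 j u).
have {jJ'}{}jJ : (j < J)%N by lia.
have jN : (offset j.+1 <= N)%N by apply: leq_trans (offset_homo _ _ jJ) JN.
set b := expR (- (c * ((offset J)%:R - (offset j.+1)%:R))).
have b0 : 0 <= b by exact: expR_ge0.
pose g0 := drop (size u) (mkseq y (offset j.+1)).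
have mass0 g : g \in G j -> mass N y f j.+1 (u ++ g) <= (g == g0)%:R * b.
  move=> gG; have sg : size (u ++ g) = offset j.+1.
    by rewrite size_cat offsetS uj (G_size _ _ gG).
  case: eqP => [gg0|gg0]; first by rewrite mul1r; apply: IH; [lia|].
  rewrite mul0r (mass_mismatch N y f j.+1 _ (offset j.+1)) ?sg //.
  rewrite -{1}sg take_size; apply/eqP => h; apply: gg0.
  by rewrite /g0 -h drop_size_cat.
rewrite /= ler_pdivrMr//; apply: (@le_trans _ _ b).
  apply: le_trans (_ : \sum_(g <- G j) (g == g0)%:R * b <= _).
    by rewrite big_seq [leRHS]big_seq; apply: ler_sum => g /mass0.
  rewrite -mulr_suml ler_piMl// -natr_sum -[leRHS]/(1%:R) ler_nat.
  rewrite (eq_bigr (fun g => if g == g0 then 1%N else 0%N)); last by move=> g _; case: eqP.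
  by rewrite -big_mkcond sum1_count (@count_uniq_mem _ _ g0)// leq_b1.
apply: le_trans (ler_wpM2l (expR_ge0 _) (G_card j)).
rewrite -expRD ler_expR offsetS natrD; lra.
Qed.

Section Cover.
Variable cov : nat -> option (nat * Sigma m).

(** The conditional probability of hitting ball [i]. Blocks are nonempty, so [N] blocks determine
    the first [N] letters and [N - j] further ones suffice; for [j >= N] the truncated subtraction
    leaves none to draw. *)
Let M i j u : R := if cov i is Some (N, y) then mass N y (N - j) j u else 0.

Let M_ge0 i j u : 0 <= M i j u.
Proof.
by rewrite /M; case: (cov i) => [[N y]|//]; case/andP: (mass_itv N y (N - j) j u).
Qed.

(** The law of total probability; once [j >= N] the outcome is settled and both sides are the same
    constant. *)
Let M_step i j u : size u = offset j ->
  M i j u = (\sum_(g <- G j) M i j.+1 (u ++ g)) / (size (G j))%:R.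
Proof.
move=> uj; rewrite /M; case: (cov i) => [[N y]|]; last by rewrite big1 ?mul0r.
have [jN|Nj] := ltnP j N; first by rewrite -(subnSK jN).
have -> : (N - j = 0)%N by lia.
have -> : (N - j.+1 = 0)%N by lia.
rewrite /= (eq_bigr (fun=> (take N u == mkseq y N)%:R)); last first.
  by move=> g _; rewrite takel_cat// uj; apply: leq_trans Nj (leq_offset j).
by rewrite sum_const_seq mulfK// gt_eqF.
Qed.

Let total j u := (\sum_(0 <= i <oo) (M i j u)%:E)%E.

(** An average below 1 has a term below 1. *)
Let total_step j u : size u = offset j -> (total j u < 1)%E ->
  exists2 g, g \in G j & (total j.+1 (u ++ g) < 1)%E.
Proof.
move=> uj tu; apply: contrapT => nex; move: tu; apply/negP; rewrite -leNgt.
have big g : g \in G j -> (1 <= total j.+1 (u ++ g))%E.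
  by move=> gG; rewrite leNgt; apply/negP => h; apply: nex; exists g.
have -> : total j u = (((size (G j))%:R^-1)%:E * \sum_(g <- G j) total j.+1 (u ++ g))%E.
  rewrite /total -nneseries_sum; last by move=> *; rewrite lee_fin.
  rewrite -nneseriesZl; last by move=> i _; apply: sume_ge0 => g _; rewrite lee_fin.
  by apply: eq_eseriesr => i _; rewrite M_step// sumEFin -EFinM mulrC.
apply: (@le_trans _ _ (((size (G j))%:R^-1)%:E * \sum_(g <- G j) 1)%E).
  by rewrite sumEFin -EFinM lee_fin sum_const_seq mul1r mulVf// gt_eqF.
apply: lee_wpmul2l; first by rewrite lee_fin invr_ge0 ltW.
by rewrite big_seq [leRHS]big_seq; apply: lee_sum.
Qed.

(* The method of conditional expectations: choose the blocks one at a time,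
   never letting the conditional expected number of hits exceed its mean. *)
Lemma concatenation_uncovered : (total 0 [::] < 1)%E ->
  exists2 x, concatenations x & forall i, ~ cover_ball (1 : R) (cov i) x.
Proof.
move=> t0.
have /choice[nxt nxtP] : forall ju : nat * seq 'I_m, exists g,
    size ju.2 = offset ju.1 -> (total ju.1 ju.2 < 1)%E ->
    g \in G ju.1 /\ (total ju.1.+1 (ju.2 ++ g) < 1)%E.
  move=> [j u] /=; have [[uj /(total_step _ _ uj)[g gG gt]]|h] :=
    pselect (size u = offset j /\ (total j u < 1)%E); first by exists g.
  by exists [::] => uj tu; case: h.
pose us := fix us j := if j is j'.+1 then us j' ++ nxt (j', us j') else [::].
have usP j : size (us j) = offset j /\ (total j (us j) < 1)%E.
  elim: j => [|j [sj tj]] /=; first by rewrite /offset big_ord0.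
  have [gG gt] := nxtP (j, us j) sj tj; split => //.
  by rewrite size_cat offsetS sj (G_size _ _ gG).
have us_size j : size (us j) = offset j by case: (usP j).
have usG j : nxt (j, us j) \in G j by have [sj tj] := usP j; case: (nxtP (j, us j) sj tj).
have us_nth j d k : (k < offset j)%N -> nth z (us (j + d)%N) k = nth z (us j) k.
  move=> kj; elim: d => [|d IH]; first by rewrite addn0.
  rewrite addnS /= nth_cat us_size -IH.
  by have := offset_homo _ _ (leq_addr d j); case: ltnP => //; lia.
pose x : Sigma m := fun k => nth z (us k.+1) k.
have xus j : mkseq x (offset j) = us j.
  apply: (@eq_from_nth _ z); rewrite ?size_mkseq ?us_size// => k kj.
  rewrite nth_mkseq// /x; have kk : (k < offset k.+1)%N := leq_offset k.+1.
  have [h|h] := leqP k.+1 j; first by rewrite -(subnKC h) us_nth.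
  by rewrite -(subnKC (ltnW h)) us_nth.
exists x => [j|i].
  suff -> : mkseq (iter (offset j) shift x) (ell j) = nxt (j, us j) by exact: usG.
  have <- : drop (offset j) (us j.+1) = nxt (j, us j) by rewrite /= drop_size_cat// us_size.
  rewrite -xus; apply: (@eq_from_nth _ z).
    by rewrite size_drop !size_mkseq offsetS; lia.
  move=> k; rewrite size_mkseq => kl; rewrite nth_drop !nth_mkseq ?iter_shiftE//.
  by rewrite offsetS; lia.
case covi : (cov i) => [[N y]|] /= xy; last by case: xy.
have [_] := usP N; apply/negP; rewrite -leNgt.
(* A point in the ball [(N, y)] shares [N] letters with [y], so after [N] blocks this single term
   already brings the total to 1. *)
have Mi : M i N (us N) = 1.
  rewrite /M covi subnn /= -xus take_mkseq ?leq_offset//.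
  suff -> : mkseq x N = mkseq y N by rewrite eqxx.
  by apply: agree_mkseq => k kN; rewrite -(bowen_ball1_agree R m _ _ _ _ xy kN).
rewrite -Mi; apply: le_trans (nneseries_lim_ge i.+1 _); last by move=> *; rewrite lee_fin.
rewrite big_nat_recr//= leeDr// sumEFin lee_fin; exact: sumr_ge0.
Qed.

End Cover.

(** Compares the exponent in the cost of a ball of order [N] with the one in [mass_le], up to a
    constant uniform in [N]. *)
Lemma offset_cost (s : R) : s < c ->
  exists K : R, forall J N, (offset J <= N < offset J.+1)%N ->
    s * N%:R <= c * (offset J)%:R + K.
Proof.
move=> sc; have [s0|s0] := leP s 0.
  exists 0 => J N /andP[JN NJ]; rewrite addr0.
  have JN' : (offset J)%:R <= N%:R :> R by rewrite ler_nat.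
  have [c0|c0] := leP c 0.
    apply: le_trans (ler_wpM2r (ler0n _ _) (ltW sc)) _; exact: ler_wnM2l.
  apply: (@le_trans _ _ 0); first by rewrite mulr_le0_ge0.
  by rewrite mulr_ge0// ltW.
(* This [eta] satisfies [s * (1 + eta) = c]. *)
have [|K KP] := ell_sublinear (c / s - 1); first by rewrite subr_gt0 ltr_pdivlMr// mul1r.
exists (s * K) => J N /andP[_]; rewrite offsetS => NJ.
have {}NJ : N%:R <= (offset J)%:R + (ell J)%:R :> R by rewrite -natrD ler_nat ltnW.
apply: le_trans (ler_wpM2l (ltW s0) (le_trans NJ (lerD (lexx _) (KP J)))) _.
by rewrite le_eqVlt; apply/orP; left; apply/eqP; field; rewrite gt_eqF.
Qed.

(** A mass distribution principle at scale 1, where a Bowen ball of order [N] lies in a cylinder of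
    length [N]. The mass of a ball is at most [expR K] times its cost, so a cover of cost below
    [expR (- K)] has expected number of hits below 1 and misses a concatenation. *)
Lemma htop_ge (Z : set (Sigma m)) : concatenations `<=` Z -> (c%:E <= htop R Z)%E.
Proof.
move=> YZ; apply: (@le_trans _ _ (htop_eps Z (1 : R))); last first.
  by apply: ereal_sup_ubound; exists 1 => //=.
apply: le_ereal_inf_tmp => _ [s /= Hs0 <-]; rewrite lee_fin leNgt; apply/negP => sc.
have [K KP] := offset_cost _ sc.
have H0 : (Hsn s 0 Z (1 : R) < (expR (- K))%:E)%E.
  apply: (@le_lt_trans _ _ 0%E); last by rewrite lte_fin expR_gt0.
  by rewrite -Hs0; apply: ereal_sup_ubound; exists 0%N.
have [_ [cov [_ covZ] <-] covK] := ereal_inf_lt H0.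
have [|x Yx xcov] := concatenation_uncovered cov; last first.
  by have [i _ /xcov] := covZ x (YZ x Yx).
apply: (@le_lt_trans _ _ (\sum_(0 <= i <oo) ((expR K)%:E * cover_cost s (cov i)))%E).
  apply: lee_nneseries => [i _ _|i _].
    rewrite lee_fin; case: (cov i) => [[N y]|//].
    by case/andP: (mass_itv N y (N - 0) 0 [::]).
  case: (cov i) => [[N y]|] /=; last by rewrite mule0.
  have [J JN] := offset_between N; rewrite -EFinM lee_fin -expRD.
  apply: le_trans (mass_le N y J _ _ _ _ _ _) _.
  - by case/andP: JN.
  - by rewrite subn0 add0n /=; case/andP: JN => + _; apply: leq_trans; exact: leq_offset.
  - by rewrite /offset big_ord0.
  - by rewrite {2}/offset big_ord0 subr0 ler_expR; have := KP _ _ JN; lra.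
rewrite nneseriesZl; last first.
  by move=> i _; case: (cov i) => [[k y]|] //=; rewrite lee_fin expR_ge0.
by rewrite -lte_pdivlMl ?expR_gt0// mule1 -expRN.
Qed.

End LowerBound.

Arguments concatenations {m}.

(** * Concatenations with prescribed word frequencies *)

Section Generic.
Variables (R : realType) (m : nat).
Implicit Types (x y : Sigma m) (v : seq 'I_m) (p : seq 'I_m -> R) (n k j : nat).

Definition freq_nbhd n (vs : seq (seq 'I_m)) (e : R) p : set (Sigma m) :=
  [set x | forall v, v \in vs -> `|emp R n x v - p v| < e].

Definition rich (c : R) p := forall vs (e : R) N, 0 < e ->
  exists2 n, (N <= n)%N & expR (c * n%:R) <= #|words n (freq_nbhd n vs e p)|%:R.

Section Discrepancy.
Variables (p : seq 'I_m -> R) (v : seq 'I_m).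
Hypothesis p01 : p v \in `[0, 1].

(** Left unnormalised so as to be additive along the orbit. *)
Definition disc n x : R := (\sum_(i < n) (starts v (iter i.+1 shift x))%:R) - n%:R * p v.

Lemma disc_emp n x : (0 < n)%N -> disc n x = n%:R * (emp R n x v - p v).
Proof. by move=> n0; rewrite /disc /emp mulrBr mulrCA divff ?mulr1// pnatr_eq0 -lt0n. Qed.

Lemma disc_cat a b x : disc (a + b) x = disc a x + disc b (iter a shift x).
Proof.
rewrite /disc big_split_ord /= natrD.
under [X in _ + X - _]eq_bigr => i _ do rewrite addnC iterD.
by ring.
Qed.

Lemma disc_abs_le n x : `|disc n x| <= n%:R.
Proof.
have [->|n0] := posnP n; first by rewrite /disc big_ord0 mul0r subrr normr0.
rewrite disc_emp// normrM normr_nat ler_piMr//.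
have := emp_itv R m n x v; move: p01; rewrite !in_itv /= ler_norml => /andP[? ?] /andP[? ?].
by apply/andP; split; lra.
Qed.

(** Only occurrences of [v] starting at the last [size v] places can see beyond the common
    prefix. *)
Lemma disc_agree n x y : mkseq x n = mkseq y n ->
  `|disc n x - disc n y| <= 2 * (size v)%:R.
Proof.
move=> xy; pose a := (n - size v)%N.
rewrite -(subnKC (leq_subr _ _ : a <= n)%N) !disc_cat.
have <- : disc a x = disc a y.
  rewrite /disc; congr (_ - _); apply: eq_bigr => i _; congr (nat_of_bool _)%:R.
  rewrite /starts; congr (_ == _); apply: agree_mkseq => k kv; rewrite !iter_shiftE.
  by apply: (mkseq_agree _ _ _ _ _ xy); have := ltn_ord i; rewrite /a in i *; lia.
have -> (r s t : R) : r + s - (r + t) = s - t by ring.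
have nav : (n - a)%:R <= (size v)%:R :> R by rewrite ler_nat /a; lia.
apply: le_trans (ler_normB _ _) _.
have := disc_abs_le (n - a) (iter a shift x).
have := disc_abs_le (n - a) (iter a shift y); lra.
Qed.

End Discrepancy.

Section Concatenate.
Variable p : seq 'I_m -> R.
Hypothesis p01 : forall v, p v \in `[0, 1].
Variable nn : nat -> nat.

Definition first_words k : seq (seq 'I_m) := pmap (@pickle_inv (seq 'I_m)) (iota 0 k).

Lemma mem_first_words v k : (pickle v < k)%N -> v \in first_words k.
Proof.
by move=> vk; rewrite mem_pmap; apply/mapP; exists (pickle v);
  rewrite ?pickleK_inv// mem_iota add0n.
Qed.

Definition stage_set k := freq_nbhd (nn k) (first_words k) k.+1%:R^-1 p.
Hypothesis nn_gt : forall k, (k < nn k)%N.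

(** Each stage is used only once its blocks are short compared with the length
    already written. *)
Definition stage j := (\max_(k < j.+1 | (nn k * k <= j)%N) k)%N.
Definition block_length j := nn (stage j).
Definition blocks j : seq (seq 'I_m) :=
  map val (enum (words (nn (stage j)) (stage_set (stage j)))).

Lemma stage_le j : (block_length j * stage j <= j)%N.
Proof.
rewrite /block_length /stage.
pose P k := (nn k * k <= j)%N.
by apply: (big_ind P) => [|a b Pa Pb|//]; [rewrite /P muln0|case: leqP].
Qed.

Lemma stage_ge k : exists J, forall j, (J <= j)%N -> (k <= stage j)%N.
Proof.
exists (maxn k (nn k * k)) => j; rewrite geq_max => /andP[kj nkj].
have kj' : (k < j.+1)%N by [].
exact: (leq_bigmax_cond (F := fun k : 'I_j.+1 => nat_of_ord k) (Ordinal kj')).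
Qed.

Lemma block_length_gt0 j : (0 < block_length j)%N.
Proof. by apply: leq_trans (nn_gt _). Qed.

(** By [stage_le] and [leq_offset], [block_length j * stage j <= offset block_length j], and the
    stage tends to infinity; [K] absorbs the blocks before [J]. *)
Lemma block_length_sublinear (eta : R) : 0 < eta ->
  exists K : R, forall j, (block_length j)%:R <= eta * (offset block_length j)%:R + K.
Proof.
move=> eta0; have [J JP] := stage_ge (Num.truncn eta^-1).+1.
exists (\sum_(i < J) (block_length i)%:R) => j; have [Jj|jJ] := leqP J j; last first.
  rewrite (bigD1 (Ordinal jJ)) //= addrCA lerDl addr_ge0//; last exact: sumr_ge0.
  by rewrite mulr_ge0// ltW.
rewrite -[leLHS]addr0; apply: lerD; last exact: sumr_ge0.
rewrite -ler_pdivrMl//.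
apply: (@le_trans _ _ (block_length j * stage j)%:R); last first.
  by rewrite ler_nat; apply: leq_trans (stage_le j) (leq_offset _ block_length_gt0 j).
rewrite natrM mulrC ler_wpM2l//; apply: ltW; apply: lt_le_trans (truncnS_gt _) _.
by rewrite ler_nat JP.
Qed.

Lemma block_disc x v (eta : R) : concatenations blocks block_length x -> 0 < eta ->
  exists J, forall j, (J <= j)%N ->
    `|disc p v (block_length j) (iter (offset block_length j) shift x)|
      <= eta * (block_length j)%:R.
Proof.
move=> xY eta0; pose k := maxn (pickle v).+1 (Num.truncn ((1 + 2 * (size v)%:R) / eta)).+1.
have [J JP] := stage_ge k; exists J => j /JP kj.
set s := stage j in kj *; set l := block_length j; set y := iter _ _ _.
have sl : s.+1%:R <= l%:R :> R by rewrite ler_nat /l /block_length nn_gt.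
have [x' x'A x'y] : exists2 x', stage_set s x' & mkseq x' l = mkseq y l.
  have /mapP[u + yu] := xY j; rewrite mem_enum => /mem_words[x' x'A x'u].
  by exists x' => //; rewrite x'u -yu.
have vs : v \in first_words s.
  by apply: mem_first_words; apply: leq_trans kj; rewrite /k leq_max ltnSn.
have l0 : 0 < l%:R :> R by rewrite ltr0n block_length_gt0.
have dx' : `|disc p v l x'| <= l%:R / s.+1%:R.
  rewrite disc_emp ?block_length_gt0// normrM normr_nat ler_wpM2l//.
  exact/ltW/(x'A v vs).
have dy := disc_agree p v (p01 v) _ _ _ x'y.
have : `|disc p v l y| <= l%:R / s.+1%:R + 2 * (size v)%:R.
  have -> : disc p v l y = disc p v l x' - (disc p v l x' - disc p v l y) by ring.
  by apply: le_trans (ler_normB _ _) _; apply: lerD.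
move/le_trans; apply.
have s0 : 0 < s.+1%:R :> R by rewrite ltr0n.
rewrite -ler_pdivrMr// mulrDl.
have -> : l%:R / s.+1%:R / l%:R = s.+1%:R^-1 :> R by rewrite mulrAC divff ?mul1r// gt_eqF.
apply: (@le_trans _ _ ((1 + 2 * (size v)%:R) / s.+1%:R)).
  rewrite [leRHS]mulrDl mul1r lerD2l ler_wpM2l ?mulr_ge0//.
  by rewrite lef_pV2.
rewrite ler_pdivrMr// -ler_pdivrMl// mulrC.
apply: ltW; apply: lt_le_trans (truncnS_gt _) _; rewrite ler_nat.
by apply: leq_trans (leqW kj); rewrite /k leq_max leqnn orbT.
Qed.

(** Blocks from [J] on contribute at most [eta / 2] times their length, and the unfinished last
    block at most [eta / 2] times the length before it, plus [K]. The constant also absorbs the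
    blocks before [J]. *)
Lemma concatenations_disc x v (eta : R) : concatenations blocks block_length x -> 0 < eta ->
  exists C : R, forall n, `|disc p v n x| <= eta * n%:R + C.
Proof.
move=> xY eta0; have eta2 : 0 < eta / 2 by rewrite divr_gt0.
have [J JP] := block_disc x v (eta / 2) xY eta2.
have [K KP] := block_length_sublinear _ eta2.
pose t := offset block_length.
have disc_t d : `|disc p v (t (J + d)%N) x| <= (t J)%:R + eta / 2 * (t (J + d)%N)%:R.
  elim: d => [|d IH].
    rewrite addn0; apply: le_trans (disc_abs_le _ _ (p01 v) _ _) _.
    by rewrite lerDl mulr_ge0// ltW.
  rewrite addnS /t offsetS disc_cat natrD mulrDr [leRHS]addrA.
  apply: le_trans (ler_normD _ _) _.
  by apply: lerD; [exact: IH|apply: JP; rewrite leq_addr].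
exists ((t J)%:R + `|K|) => n; have [nJ|Jn] := ltnP n (t J).
  apply: le_trans (disc_abs_le _ _ (p01 v) _ _) _.
  have : n%:R <= (t J)%:R :> R by rewrite ler_nat ltnW.
  have : 0 <= eta * n%:R by rewrite mulr_ge0// ltW.
  have := normr_ge0 K; lra.
have [j /andP[jn nj]] := offset_between _ block_length_gt0 n.
have Jj : (J <= j)%N.
  rewrite leqNgt; apply/negP => jJ; have := offset_homo block_length _ _ jJ.
  by rewrite /t in Jn; lia.
rewrite -(subnKC jn) disc_cat; apply: le_trans (ler_normD _ _) _.
have := disc_abs_le p v (p01 v) (n - offset block_length j)
  (iter (offset block_length j) shift x).
have := disc_t (j - J)%N; rewrite subnKC// /t.
have : (n - offset block_length j)%:R <= (block_length j)%:R :> R.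
  by rewrite ler_nat; rewrite offsetS in nj; lia.
have := KP j; have := ler_norm K.
rewrite subnKC//.
have : eta * (offset block_length j)%:R <= eta * n%:R by rewrite ler_pM2l// ler_nat.
lra.
Qed.

Lemma concatenations_emp x v : concatenations blocks block_length x ->
  emp R n x v @[n --> \oo] --> p v.
Proof.
move=> xY; apply/cvgrPdist_le => e e0; have e2 : 0 < e / 2 by rewrite divr_gt0.
have [C CP] := concatenations_disc x v _ xY e2.
exists (Num.truncn (C / (e / 2))).+1 => // n /= nC.
have n0 : (0 < n)%N by apply: leq_trans nC.
have nR : 0 < n%:R :> R by rewrite ltr0n.
rewrite distrC -(ler_pM2l nR) -[X in X * _]normr_nat -normrM -disc_emp//.
apply: le_trans (CP n) _.
have : C <= (e / 2) * n%:R.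
  rewrite -ler_pdivrMl// mulrC; apply: ltW; apply: lt_le_trans (truncnS_gt _) _.
  by rewrite ler_nat.
lra.
Qed.

End Concatenate.

Lemma htop_rich (z : 'I_m) (c : R) p (Z : set (Sigma m)) :
  (forall v, p v \in `[0, 1]) -> rich c p ->
  (forall x, (forall v, emp R n x v @[n --> \oo] --> p v) -> Z x) ->
  (c%:E <= htop R Z)%E.
Proof.
move=> p01 pr pZ.
have /choice[nn nnP] k : exists n, (k < n)%N /\
    expR (c * n%:R) <= #|words n (freq_nbhd n (first_words k) k.+1%:R^-1 p)|%:R.
  have k0 : 0 < k.+1%:R^-1 :> R by rewrite invr_gt0 ltr0n.
  by have [n kn h] := pr (first_words k) _ k.+1 k0; exists n.
have nn_gt k : (k < nn k)%N by case: (nnP k).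
apply: (htop_ge R m z (blocks p nn) (block_length nn)).
- by move=> j; rewrite map_inj_uniq ?enum_uniq//; exact: val_inj.
- by move=> j g /mapP[u _ ->]; rewrite size_tuple.
- exact: block_length_gt0.
- by move=> j; rewrite size_map -cardE; case: (nnP (stage nn j)).
- exact: block_length_sublinear.
- by move=> x xY; apply: pZ => v; exact: (concatenations_emp p p01 nn nn_gt x v xY).
Qed.

End Generic.

Arguments rich {R m}.
Arguments freq_nbhd {R m}.

(** * Bounds on an upper limit as eventual inequalities *)

Section Limsup.
Variables (R : realType) (u : nat -> R) (a : R).

Lemma limn_esup_le_near : (limn_esup (fun n => (u n)%:E) <= a%:E)%E ->
  forall e, 0 < e -> exists N, forall n, (N <= n)%N -> u n <= a + e.
Proof.
move=> ua e e0.
have /ereal_inf_lt[_ [V [N _ NV] <-] VE] : (limn_esup (fun n => (u n)%:E) < (a + e)%:E)%E.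
  by apply: le_lt_trans ua _; rewrite lte_fin ltrDl.
exists N => n Nn; rewrite -lee_fin; apply: le_trans (ltW VE).
by apply: ereal_sup_ubound; exists n => //; apply: NV.
Qed.

Lemma near_limn_esup_le :
  (forall e, 0 < e -> exists N, forall n, (N <= n)%N -> u n <= a + e) ->
  (limn_esup (fun n => (u n)%:E) <= a%:E)%E.
Proof.
move=> ua; apply/lee_addgt0Pr => e /ua[N uN].
apply: (@le_trans _ _ (ereal_sup [set (u n)%:E | n in [set n | (N <= n)%N]])).
  by apply: ereal_inf_lbound; exists [set n | (N <= n)%N] => //; exists N.
by apply: ge_ereal_sup => _ [n /= /uN un <-]; rewrite -EFinD lee_fin.
Qed.

End Limsup.

(** * The compactness argument on the space of states *)

Section Semicontinuity.
Variables (R : realType) (B : normedModType R) (m r : nat) (z : 'I_m).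
Variables (W : set B) (Phi : ('I_r -> Sigma m) -> dual B).
Hypothesis Phi_cont : weakstar_continuous Phi.
Variables (alpha : dual B) (c : R).

Let phi (w : B) (x : 'I_r -> Sigma m) : R := Phi x w.

Lemma pairVE n x w : pairV Phi n x w = Vstat (phi w) n x.
Proof. by []. Qed.

Let phi_osc w (e : R) : 0 < e -> exists k, oscillation_lt (phi w) k e.
Proof. by apply: uniform_continuity => x d d0; exact: Phi_cont. Qed.

Import ArrowAsProduct.
Let states := (seq 'I_m -> R)%type.

Definition constrained (U : set states) (ws : seq B) (d : R) n : set (Sigma m) :=
  [set x | U (emp R n x) /\ forall w, w \in ws -> pairV Phi n x w <= alpha w + d].

(** The strict gap [c' < c] yields a strict entropy bound, and the margin [d > 0] leaves room for
    perturbing [alpha]. These sets are closed under subsets and finite unions, which makes their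
    complements a filter. *)
Definition few_words (U : set states) := exists ws : seq B, exists d C c' : R, exists N,
  [/\ forall w, w \in ws -> W w, 0 < d, 0 <= C, c' < c &
   forall n, (N <= n)%N -> #|words n (constrained U ws d n)|%:R <= C * expR (c' * n%:R)].

Lemma constrainedS (U U' : set states) ws ws' d d' n :
  U `<=` U' -> {subset ws' <= ws} -> d <= d' ->
  constrained U ws d n `<=` constrained U' ws' d' n.
Proof.
move=> UU' wsS dd' x [Ux Vx]; split; first exact: UU'.
by move=> w /wsS/Vx/le_trans; apply; rewrite lerD2l.
Qed.

Lemma few_wordsS (U U' : set states) : U `<=` U' -> few_words U' -> few_words U.
Proof.
move=> UU' [ws [d [C [c' [N [wsW d0 C0 cc' H]]]]]].
exists ws, d, C, c', N; split => // n Nn; apply: le_trans (H n Nn).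
by rewrite ler_nat; apply/subset_leq_card/wordsS/constrainedS.
Qed.

Lemma few_words_contradictory (U : set states) w (d : R) N : W w -> 0 < d ->
  (forall n x, (N <= n)%N -> U (emp R n x) -> alpha w + d < pairV Phi n x w) ->
  few_words U.
Proof.
move=> Ww d0 H; exists [:: w], d, 0, (c - 1), N; split => //.
- by move=> _ /[!inE]/eqP->.
- by rewrite ltrBlDr ltrDl.
move=> n Nn; rewrite (_ : constrained _ _ _ _ = set0) ?words0 ?cards0 ?mul0r//.
rewrite -subset0 => x [/(H _ _ Nn) + /(_ w)]; rewrite inE eqxx => lt /(_ isT).
by rewrite leNgt lt.
Qed.

Lemma few_wordsU (U U' : set states) : few_words U -> few_words U' -> few_words (U `|` U').
Proof.
move=> [ws [d [C [c1 [N [wsW d0 C0 c1c H]]]]]].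
move=> [ws' [d' [C' [c1' [N' [wsW' d0' C0' c1c' H']]]]]].
pose c2 := Num.max c1 c1'.
exists (ws ++ ws'), (Num.min d d'), (C + C'), c2, (maxn N N'); split.
- by move=> w; rewrite mem_cat => /orP[/wsW|/wsW'].
- by rewrite lt_min d0.
- exact: addr_ge0.
- by rewrite gt_max c1c.
move=> n; rewrite geq_max => /andP[/H{}H /H'{}H'].
set A := constrained U ws d n in H; set A' := constrained U' ws' d' n in H'.
have sub : constrained (U `|` U') (ws ++ ws') (Num.min d d') n `<=` A `|` A'.
  move=> x [[Ux|Ux] Vx]; [left|right].
    apply: (@constrainedS U _ (ws ++ ws') _ (Num.min d d')); rewrite ?ge_min ?lexx//.
    by move=> w; rewrite mem_cat => ->.
  apply: (@constrainedS U' _ (ws ++ ws') _ (Num.min d d')); rewrite ?ge_min ?lexx ?orbT//.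
  by move=> w; rewrite mem_cat => ->; rewrite orbT.
apply: (@le_trans _ _ (#|words n A|%:R + #|words n A'|%:R)).
  rewrite -natrD ler_nat; apply: leq_trans (subset_leq_card (wordsS _ _ _ _ sub)) _.
  by rewrite wordsU cardsU leq_subr.
have le_exp a : a <= c2 -> expR (a * n%:R) <= expR (c2 * n%:R).
  by move=> ac2; rewrite ler_expR ler_wpM2r.
rewrite mulrDl; apply: lerD.
  by apply: le_trans H _; rewrite ler_wpM2l// le_exp// le_max lexx.
by apply: le_trans H' _; rewrite ler_wpM2l// le_exp// le_max lexx orbT.
Qed.

Lemma few_words_unvisited (U : set states) :
  (forall n x, ~ U (emp R n x)) -> few_words U.
Proof.
move=> nU; exists [::], 1, 0, (c - 1), 0%N; split => //; first by rewrite ltrBlDr ltrDl.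
move=> n _; rewrite (_ : constrained _ _ _ _ = set0) ?words0 ?cards0 ?mul0r//.
by rewrite -subset0 => x [/nU].
Qed.

(** A state is a bare family of numbers with no integral attached, so [Lam] at a depth of small
    oscillation stands for the integral of [phi w] against the [r]-fold product of [p]. *)
Definition admissible (p : states) := forall w, W w -> forall e : R, 0 < e ->
  exists2 k, oscillation_lt (phi w) k e & Lam (phi w) z k p <= alpha w + e.

Lemma proj_cvg (p : states) v : q v @[q --> nbhs p] --> p v.
Proof. exact: (@proj_continuous _ (fun=> R) v p). Qed.

Lemma not_admissible_few_words p : ~ admissible p ->
  exists2 U : set states, nbhs p U & few_words U.
Proof.
move=> np; have [w [Ww [e [e0 pw]]]] : exists w, W w /\ exists e : R, 0 < e /\
    forall k, oscillation_lt (phi w) k e -> alpha w + e < Lam (phi w) z k p.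
  apply: contrapT => nw; apply: np => w Ww e e0; apply: contrapT => nk; apply: nw.
  exists w; split => //; exists e; split => // k osc.
  by rewrite ltNge; apply/negP => h; apply: nk; exists k.
(* Half of the violation [e] pays for replacing the V-statistic by [Lam]; the other half remains as
   the margin. *)
have e2 : 0 < e / 2 by rewrite divr_gt0.
have [k osc] := phi_osc w _ e2.
have {pw} pk : alpha w + e < Lam (phi w) z k p.
  by apply: pw => x y /osc; have := e2; lra.
exists [set q | alpha w + e < Lam (phi w) z k q].
  exact: (cvgr_gt _ (Lam_cvg R m r (phi w) z _ (nbhs p) k id p (proj_cvg p))).
apply: (few_words_contradictory _ w (e / 2) 1) => // n x n0 /=.
have := Vstat_Lam R m r (phi w) z n x k _ n0 (ltW e2) osc.
rewrite pairVE ler_norml => /andP[+ _] Ux; move: Ux; lra.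
Qed.

Lemma not_rich_few_words p c' : c' < c -> ~ rich c' p ->
  exists2 U : set states, nbhs p U & few_words U.
Proof.
move=> cc' np; have [vs [e [N [e0 H]]]] : exists vs (e : R) N, 0 < e /\
    forall n, (N <= n)%N -> #|words n (freq_nbhd n vs e p)|%:R <= expR (c' * n%:R).
  apply: contrapT => nvs; apply: np => vs e N e0; apply: contrapT => nn; apply: nvs.
  exists vs, e, N; split => // n Nn; rewrite leNgt; apply/negP => h; apply: nn.
  by exists n => //; exact: ltW.
exists [set q : states | forall v, v \in vs -> `|q v - p v| < e].
  elim: vs {H} => [|v vs IH]; first by apply: filterS filterT => q.
  have /cvgrPdist_lt/(_ _ e0) pv := proj_cvg p v.
  apply: filterS (filterI pv IH) => q [pqv qvs] v' /[!inE]/predU1P[->|/qvs//].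
  by rewrite distrC.
exists [::], 1, 1, c', N; split => // n /H{}H; rewrite mul1r.
by apply: le_trans H; rewrite ler_nat; apply/subset_leq_card/wordsS => x [].
Qed.

(** The complements of the sets with few words form a filter, proper because [setT] has many words.
    It contains the compact cube [K], where all empirical frequencies lie. A cluster point has no
    neighbourhood with few words, hence is admissible and rich. *)
Lemma exists_rich_admissible : ~ few_words setT ->
  exists p : states, [/\ forall v, p v \in `[0, 1], admissible p &
    forall c', c' < c -> rich c' p].
Proof.
move=> nT; pose F : set_system states := [set A | few_words (~` A)].
have FF : ProperFilter F.
  apply: Build_ProperFilter_ex.
    move=> A FA; apply: contrapT => nA; apply: nT.
    by apply: few_wordsS FA => q _ Aq; apply: nA; exists q.
  split => [|A A' FA FA'|A A' AA' FA].
  - by rewrite /F /= setCT; apply: few_words_unvisited => n x [].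
  - by rewrite /F /= setCI; exact: few_wordsU.
  - by apply: few_wordsS FA; exact: subsetC.
pose K : set states := [set q | forall v, [set` `[0, 1]] (q v)].
have FK : F K.
  by apply: few_words_unvisited => n x; apply => v; exact: emp_itv.
have Kc : compact K.
  by apply: (@tychonoff _ (fun=> R) (fun=> [set` `[0, 1]])) => _; exact: segment_compact.
have [p [Kp clp]] := Kc F FF FK; exists p.
have no U : nbhs p U -> few_words U -> False.
  move=> pU fU; have [|q [/= nUq Uq]] := clp (~` U) U _ pU; last exact: nUq Uq.
  by rewrite /F /= setCK.
split => //.
  by apply: contrapT => /not_admissible_few_words[U]; exact: no.
by move=> c' cc'; apply: contrapT => /(not_rich_few_words _ _ cc')[U]; exact: no.
Qed.

Lemma admissible_EPhi p x : admissible p -> (forall v, emp R n x v @[n --> \oo] --> p v) ->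
  EPhi Phi alpha W x.
Proof.
move=> pad px w Ww; apply: near_limn_esup_le => e e0.
(* One third each for the constraint on [p], the convergence of [Lam], and the truncation error. *)
have e3 : 0 < e / 3 by rewrite divr_gt0.
have [k osc pk] := pad w Ww _ e3.
have Lk : Lam (phi w) z k (emp R n x) @[n --> \oo] --> Lam (phi w) z k p.
  exact: (Lam_cvg R m r (phi w) z nat \oo k (fun n => emp R n x) p px).
have pk' : Lam (phi w) z k p < alpha w + e / 3 + e / 3 by lra.
have [N _ NP] := cvgr_lt _ Lk _ pk'.
exists N.+1 => n Nn; have n0 : (0 < n)%N by apply: leq_trans Nn.
have := NP n (ltnW Nn); have := Vstat_Lam R m r (phi w) z n x k _ n0 (ltW e3) osc.
rewrite pairVE ler_norml => /andP[_ +] /=; lra.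
Qed.

Lemma htop_EPhi_ge : ~ few_words setT -> (c%:E <= htop R (EPhi Phi alpha W))%E.
Proof.
move=> /exists_rich_admissible[p [p01 pad pr]].
(* Richness is available only strictly below [c], so the bound is proved for each [c - e]. *)
apply/lee_subgt0Pr => e e0; rewrite -EFinB.
apply: (htop_rich R m z (c - e) p) => //; first by apply: pr; rewrite ltrBlDr ltrDl.
by move=> x; exact: admissible_EPhi.
Qed.

Lemma htop_EPhi_lt : few_words setT -> exists ws : seq B, exists2 delta : R, 0 < delta &
  forall beta : dual B, (forall w, w \in ws -> `|beta w - alpha w| < delta) ->
    (htop R (EPhi Phi beta W) < c%:E)%E.
Proof.
move=> [ws [d [C [c' [N [wsW d0 C0 cc' H]]]]]]; have d2 : 0 < d / 2 by rewrite divr_gt0.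
(* One half of the margin covers the passage from [alpha] to [beta], the other the excess of the
   V-statistics over their upper limit. *)
exists ws, (d / 2) => // beta bw.
apply: (@le_lt_trans _ _ c'%:E); last by rewrite lte_fin.
apply: (htop_le R m z _ _ _ _ _ H) => x Ex N'.
have /choice[f fP] w : exists N0, w \in ws -> forall n, (N0 <= n)%N ->
    pairV Phi n x w <= beta w + d / 2.
  have [wws|] := boolP (w \in ws); last by exists 0%N.
  by have [N0 h] := limn_esup_le_near _ _ _ (Ex w (wsW w wws)) _ d2; exists N0.
exists (maxn N' (\max_(w <- ws) f w)); first exact: leq_maxl.
split => // w wws; apply: le_trans (fP w wws _ _) _.
  by rewrite leq_max orbC (leq_bigmax_seq (F := f)).
have := bw w wws; rewrite ltr_norml => /andP[_]; lra.
Qed.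

End Semicontinuity.

Theorem theorem5p1 (R : realType) (B : completeNormedModType R) (m r : nat)
    (hm : (2 <= m)%N) (hr : (1 <= r)%N) (W : set B)
    (Phi : ('I_r -> Sigma m) -> dual B)
    (hPhi : weakstar_continuous Phi) :
  weakstar_usc (LPhi Phi W) (fPhi Phi W).
Proof.
move=> alpha _ c fc; have z : 'I_m := Ordinal (ltnW hm).
(* If all states together have few words, the finite witness [ws] and its margin give the
   neighbourhood of [alpha]; otherwise the entropy at [alpha] is at least [c], against [fc]. *)
have [few|many] := pselect (few_words R B m r W Phi alpha c setT).
  have [ws [d d0 H]] := htop_EPhi_lt R B m r z W Phi alpha c few.
  by exists ws; exists d; [exact: d0 | move=> beta _ bw; exact: (H beta bw)].
suff /negP : ~~ (fPhi Phi W alpha < c%:E)%E by move/(_ fc).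
rewrite -leNgt; exact: (htop_EPhi_ge R B m r z W Phi hPhi alpha c many).
Qed.
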